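(* Let $n$ be a positive integer with $n\equiv 3\pmod 5$. Then $$\sum_{k=0}^{n-1}\frac{(1+q^{5k+1})(q^2;q^5)_k^5}{(1+q)(q^5;q^5)_k^5}q^{5k}\equiv\frac{(q^3,q^4,q^4,q^7;q^5)_{(4n-2)/5}}{(q^2,q^5,q^5,q^6;q^5)_{(4n-2)/5}}\left(1+\frac{[4n]^2q^{-n}}{[3n]^2}\right)\pmod{\Phi_n(q)^5}.$$
   Context: Here $q$ is an indeterminate. For a nonnegative integer $k$, $(a;q)_k=(1-a)(1-aq)\cdots(1-aq^{k-1})$ (with $(a;q)_0=1$), and $(a_1,\ldots,a_r;q)_k=\prod_{i=1}^r(a_i;q)_k$; the base may be replaced, e.g. $(a;q^5)_k=(1-a)(1-aq^5)\cdots(1-aq^{5(k-1)})$. The $q$-integer is $[N]=\frac{1-q^N}{1-q}$. The $n$-th cyclotomic polynomial is $\Phi_n(q)=\prod_{1\le j\le n,\ \gcd(j,n)=1}(q-\zeta^j)$, where $\zeta$ is a primitive $n$-th root of unity. Congruence convention: for rational functions $F(q),G(q)$ in $q$ (over $\mathbb{Z}[q]$), $F(q)\equiv G(q)\pmod{\Phi_n(q)^r}$ means that $F(q)-G(q)$ can be written as $U(q)/V(q)$ with $U(q),V(q)\in\mathbb{Z}[q]$, $\gcd(V(q),\Phi_n(q))=1$ and $\Phi_n(q)^r\mid U(q)$. *)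

(* Defs.v *)
From mathcomp Require Import all_boot all_order all_algebra all_field.

Set Implicit Arguments.
Unset Strict Implicit.
Unset Printing Implicit Defensive.

Import GRing.Theory.
Local Open Scope ring_scope.

Notation ratfrac := {fraction {poly int}}.
Local Notation "p %:F" := (@FracField.tofrac {poly int} p).

Definition qvar : ratfrac := 'X%:F.

Definition qpoch (a b : ratfrac) (k : nat) : ratfrac :=
  \prod_(i < k) (1 - a * b ^+ i).

(* (a_1, ..., a_r ; b)_k *)
Definition qpochs (s : seq ratfrac) (b : ratfrac) (k : nat) : ratfrac :=
  \prod_(a <- s) qpoch a b k.

Definition qint (N : nat) : ratfrac := (1 - qvar ^+ N) / (1 - qvar).

(* F = G mod 'Phi_n ^ r.  Over {poly int}, [%|] and [coprimep] are defined by
   pseudo-division.  Since 'Phi_n is monic, [%|] is divisibility in Z[q] here,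
   and [coprimep] (no common factor of positive degree) agrees with a trivial
   gcd in Z[q], as no constant other than 1 and -1 divides 'Phi_n. *)
Definition congr_Phi (n r : nat) (F G : ratfrac) : Prop :=
  exists U V : {poly int},
    [/\ V != 0, coprimep V 'Phi_n, 'Phi_n ^+ r %| U & F - G = U%:F / V%:F].

(* Main.v *)
From HB Require Import structures.
Require Import Defs.
From mathcomp Require Import all_boot all_order all_algebra all_field.
From mathcomp Require Import ring zify.

Set Implicit Arguments.
Unset Strict Implicit.
Unset Printing Implicit Defensive.

Import GRing.Theory.
Local Open Scope ring_scope.

(** Write n = 5r + 3, m = (4n - 2)/5 = 4r + 2, p = q^5, t = q^(4n) = q^2 p^m
    and Phi for the n-th cyclotomic polynomial.  For k > m the factor 1 - t of
    (q^2;p)_k is divisible by Phi, hence so is the k-th summand, five times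
    over, and the sum may be stopped at k = m.

    Deform the remaining sum: replace two of the factors (q^2;p)_k by
    (q^2 x, q^2/x; p)_k and two more by (q^2 y, q^2/y; p)_k, and the factors
    (p;p)_k below them by (px, p/x; p)_k and (py, p/y; p)_k.  Since
    (1 - q^e x)(1 - q^e/x) = (1 - q^e)^2 - X q^e with X = x + 1/x - 2, the
    outcome is a symmetric function F(X, Y), and F(0, 0) is wanted.

    At x = t, that is X = T := (1 - t)^2/t, the factor q^2/t = p^(-m) makes
    the sum terminate, and F(T, Y) is a very-well-poised balanced 8phi7 with
    a = q^2 and b = q.  Jackson's sum evaluates it as
      (q^3, q^7, q^4 y, q^4/y; p)_m / (q^2, q^6, py, p/y; p)_m.
    The idea is to take Y = -T.  By symmetry F(X, -X) is even in X, so
    F(T, -T) - F(0, 0) is a multiple of T^2, which has order 4 at Phi; one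
    more factor Phi appears because F(X, -X) is zero modulo Phi identically
    in X.  Hence F(0, 0) = F(T, -T) modulo Phi^5.

    Compare now the product at Y = -T with its value at Y = 0.  Among the
    factors that depend on Y only (1 - q^(3n))^2 is divisible by Phi, and it
    becomes exactly (1 - q^(3n))^2 (1 + [4n]^2 q^(-n)/[3n]^2).  The others are
    units at Phi and change by multiples of Phi^2.  Since the product has order
    at least 3, the congruence follows.

    Three facts carry this argument.
    - [jackson_sum] is Jackson's summation, proved by a telescoping (WZ)
      certificate that is a polynomial identity.
    - [cleared_sum_root] is the vanishing of F(X, -X) modulo Phi.  Let q be a
      primitive n-th root of unity and clear denominators.  Because q^n = 1,
      the numerator factors depending on Z = X^2 are the denominator factors
      shifted by r places; up to a constant they form a window of r
      consecutive factors, which is a polynomial of degree 4r in p^k.  With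
      the remaining factors the summand is (q^2;p)_k/(p;p)_k times a polynomial
      in p^k, of degree at most m and without constant term; as q^2 = p^(-m),
      the terminating q-binomial theorem makes the sum zero.
    - [vanish_product] compares the product at Y = -T with the right-hand side.

    Congruences are computed in the localization of Z[q] at Phi, where being
    coprime to Phi means not vanishing at a fixed primitive n-th root of
    unity. *)

(** * Shifted factorials *)

Definition poch {A : comPzRingType} (p a : A) (k : nat) : A :=
  \prod_(i < k) (1 - a * p ^+ i).

(** (c, d; p)_k written with s = c + d and t = c d, so that the conjugate pair
    c, d need not lie in the ring: for Y = -T the equation y + 1/y = 2 - T has
    no solution in Q(q). *)
Definition poch2 {A : comPzRingType} (p s t : A) (k : nat) : A :=
  \prod_(i < k) (1 - s * p ^+ i + t * p ^+ i ^+ 2).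

Lemma poch0 {A : comPzRingType} (p a : A) : poch p a 0 = 1.
Proof. exact: big_ord0. Qed.

Lemma pochS {A : comPzRingType} (p a : A) k :
  poch p a k.+1 = poch p a k * (1 - a * p ^+ k).
Proof. exact: big_ord_recr. Qed.

Lemma pochSl {A : comPzRingType} (p a : A) k :
  poch p a k.+1 = (1 - a) * poch p (a * p) k.
Proof.
rewrite /poch big_ord_recl expr0 mulr1; congr (_ * _).
by apply: eq_bigr => i _; rewrite -mulrA -exprS.
Qed.

Lemma poch_cat {A : comPzRingType} (p a : A) i j :
  poch p a (i + j) = poch p a i * poch p (a * p ^+ i) j.
Proof.
rewrite /poch big_split_ord /=; congr (_ * _).
by apply: eq_bigr => l _; rewrite exprD mulrA.
Qed.

Lemma poch_qE {A : comPzRingType} (q : A) e k :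
  poch (q ^+ 5) (q ^+ e) k = \prod_(i < k) (1 - q ^+ (5 * i + e)).
Proof. by apply: eq_bigr => i _; rewrite -exprM -exprD addnC. Qed.

Lemma poch2S {A : comPzRingType} (p s t : A) k :
  poch2 p s t k.+1 = poch2 p s t k * (1 - s * p ^+ k + t * p ^+ k ^+ 2).
Proof. exact: big_ord_recr. Qed.

(** * Jackson's summation *)

(** The identity behind the telescoping in [jackson_sum], with Q = p^k,
    U = p^(m-k) and M = p^m: the left-hand side comes from the difference of a
    summand for m + 1 and a multiple of the summand for m, the right-hand side
    from G (k + 1) - G k. Taking U in place of M/Q, and w in place of a/(bcd),
    keeps it free of denominators. *)
Lemma jackson_certificate {A : comPzRingType} (w b s t p Q U : A) :
  let a := w * b * t in let v := w * p in let M := Q * U in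
  (1 - a * Q ^+ 2) *
    ((1 - p * M) * (1 - v * t * M) * (1 - v * b * s * M + (v * b) ^+ 2 * t * M ^+ 2)
       * ((1 - v * U) * (1 - a * v * M * Q))
     - (1 - a * v * M) * (1 - v * b * M) * (1 - v * s * M + v ^+ 2 * t * M ^+ 2)
       * ((1 - p * U) * (1 - a * p * M * Q)))
  = - (p * U * (1 - a * v * p * M ^+ 2)) *
    (w * ((1 - a * Q) * (1 - b * Q) * (1 - s * Q + t * Q ^+ 2)
       * ((1 - a * v * M * Q) * (1 - p * U)))
     - (1 - Q) * (1 - w * t * Q) * (1 - w * b * s * Q + (w * b) ^+ 2 * t * Q ^+ 2)
       * ((1 - v * U) * (1 - a * p * M * Q))).
Proof. by move=> a v M; rewrite /M /a /v; ring. Qed.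

(** With c + d = s and c d = t one has a = w b c d and v = a p/(b c d).  The two
    remaining numerator parameters a v p^m and p^(-m) of the 8phi7 series, and
    the denominator parameters that belong to them, are rewritten through the
    factorials of lengths m - k and m + k in [tail]; this is the shape that the
    sum has in Bailey's lemma. *)
Section Jackson.
Variables (K : fieldType) (p w b s t : K).
Let v := w * p.
Let a := w * b * t.

Let num k := poch p a k * poch p b k * poch2 p s t k.
Let den k := poch p p k * poch p (v * t) k * poch2 p (v * b * s) ((v * b) ^+ 2 * t) k.
Let tail i j := poch p v i * poch p (a * v) j / (poch p p i * poch p (a * p) j).

Definition jackson_term m k :=
  (1 - a * p ^+ k ^+ 2) * p ^+ k * (num k * w ^+ k / den k) * tail (m - k) (m + k).
Definition jackson_prod m :=
  (1 - a) * (poch p (a * v) m * poch p (v * b) m * poch2 p (v * s) (v ^+ 2 * t) m)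
  / den m.

Hypothesis p_neq : forall k, 1 - p ^+ k.+1 != 0.
Hypothesis ap_neq : forall k, 1 - a * p ^+ k.+1 != 0.
Hypothesis vt_neq : forall k, 1 - v * t * p ^+ k != 0.

(** Both sides satisfy the same first-order recurrence in m: N / D is the
    ratio of consecutive products, and the summands follow it up to the
    difference of consecutive values of G. *)
Lemma jackson_sum m :
  (forall k, (k < m)%N ->
     1 - v * b * s * p ^+ k + (v * b) ^+ 2 * t * p ^+ k ^+ 2 != 0) ->
  \sum_(k < m.+1) jackson_term m k = jackson_prod m.
Proof.
have pp_neq k : poch p p k != 0.
  by apply/prodf_neq0 => i _; rewrite -exprS p_neq.
have app_neq k : poch p (a * p) k != 0.
  by apply/prodf_neq0 => i _; rewrite -mulrA -exprS ap_neq.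
have vtp_neq k : poch p (v * t) k != 0 by apply/prodf_neq0 => i _; rewrite vt_neq.
elim: m => [|m IHm] q_neq.
  rewrite big_ord1 /jackson_term /jackson_prod /num /den /tail /poch /poch2 !big_ord0.
  by rewrite !expr0 expr1n; field; rewrite oner_neq0.
have qq_neq k : (k <= m.+1)%N -> poch2 p (v * b * s) ((v * b) ^+ 2 * t) k != 0.
  move=> lekm; apply/prodf_neq0 => i _; apply: q_neq.
  exact: leq_trans (ltn_ord i) lekm.
have den_neq k : (k <= m.+1)%N -> den k != 0.
  by move=> lekm; rewrite /den !mulf_neq0 ?qq_neq.
have {}IHm := IHm (fun k ltkm => q_neq k (ltnW ltkm)).
pose M := p ^+ m.
pose D := (1 - p * M) * (1 - v * t * M) * (1 - v * b * s * M + (v * b) ^+ 2 * t * M ^+ 2).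
pose N := (1 - a * v * M) * (1 - v * b * M) * (1 - v * s * M + v ^+ 2 * t * M ^+ 2).
have D_neq : D != 0.
  by rewrite /D !mulf_neq0 ?vt_neq ?q_neq // /M -exprS p_neq.
(* G is a summand stripped of its very-well-poised factor, with some factorials
   shifted by one; the constant C is then forced by the case k = m.+1. *)
pose C := - (p * M * (1 - a * v * p * M ^+ 2)) / D.
pose G k := C * (num k * w ^+ k / den k)
  * ((1 - p ^+ k) * (1 - w * t * p ^+ k)
     * (1 - w * b * s * p ^+ k + (w * b) ^+ 2 * t * p ^+ k ^+ 2))
  * tail (m.+1 - k) (m + k).
have prodS : jackson_prod m.+1 = N / D * jackson_prod m.
  rewrite /jackson_prod /den /N /D !pochS !poch2S -/M.
  have := D_neq; rewrite /D !mulf_eq0 !negb_or -andbA => /and3P[D1 D2 D3].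
  by field; rewrite pp_neq vtp_neq qq_neq ?leqnSn // D1 D2 D3.
have telescope j : (j <= m.+1)%N ->
    \sum_(k < j) (jackson_term m.+1 k - N / D * jackson_term m k) = G j.
  elim: j => [|j IHj] lejm; first by rewrite big_ord0 /G !expr0 subrr !(mulr0, mul0r).
  rewrite big_ord_recr IHj ?(ltnW lejm) //= {IHj}.
  pose U := p ^+ (m - j); pose Q := p ^+ j.
  have defM : M = Q * U by rewrite -exprD subnKC.
  have mS : (m.+1 - j = (m - j).+1)%N by rewrite subSn.
  pose z := poch p v (m - j) * poch p (a * v) (m + j)
     / (poch p p (m - j).+1 * poch p (a * p) (m + j).+1).
  have := pp_neq (m - j).+1; have := app_neq (m + j).+1.
  rewrite !pochS -/U exprD -/M -/Q !mulf_eq0 !negb_or => /andP[x1 x2] /andP[x3 x4].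
  have tail1 : tail (m.+1 - j) (m.+1 + j) = z * ((1 - v * U) * (1 - a * v * M * Q)).
    rewrite /tail /z mS addSn !pochS -/U exprD -/M -/Q.
    by field; rewrite x1 x2 x3 x4.
  have tail2 : tail (m - j) (m + j) = z * ((1 - p * U) * (1 - a * p * M * Q)).
    rewrite /tail /z !pochS -/U exprD -/M -/Q.
    by field; rewrite x1 x2 x3 x4.
  have tail3 : tail (m.+1 - j) (m + j) = z * ((1 - v * U) * (1 - a * p * M * Q)).
    rewrite /tail /z mS !pochS -/U exprD -/M -/Q.
    by field; rewrite x1 x2 x3 x4.
  have tail4 : tail (m.+1 - j.+1) (m + j.+1) = z * ((1 - a * v * M * Q) * (1 - p * U)).
    rewrite /tail /z subSS addnS !pochS -/U exprD -/M -/Q.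
    by field; rewrite x1 x2 x3 x4.
  have baseS : num j.+1 * w ^+ j.+1 / den j.+1 *
      ((1 - p ^+ j.+1) * (1 - w * t * p ^+ j.+1)
     * (1 - w * b * s * p ^+ j.+1 + (w * b) ^+ 2 * t * p ^+ j.+1 ^+ 2)) =
      (num j * w ^+ j / den j)
      * (w * ((1 - a * Q) * (1 - b * Q) * (1 - s * Q + t * Q ^+ 2))).
    have := den_neq _ lejm.
    rewrite /num /den !pochS !poch2S -/Q !mulf_eq0 !negb_or -!andbA.
    move=> /andP[y1] /andP[y2] /and4P[y3 y4 y5 y6].
    rewrite !(exprS _ j) -/Q /v in y3 y4 y5 y6 *.
    by field; rewrite y1 y2 y3 y4 y5 y6.
  have -> : G j.+1 = C * (num j * w ^+ j / den j
      * (w * ((1 - a * Q) * (1 - b * Q) * (1 - s * Q + t * Q ^+ 2))))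
      * (z * ((1 - a * v * M * Q) * (1 - p * U))).
    by rewrite -baseS -tail4 /G !mulrA.
  rewrite /G tail3 /jackson_term tail1 tail2 -/Q /C.
  set B := num j * _ / _.
  have := jackson_certificate w b s t p Q U; rewrite /= -/a -/v -defM -/D -/N => cert.
  move: cert D_neq; generalize D, N, z, B => D' N' z' B' cert D_neq'.
  apply: (mulfI D_neq').
  transitivity (B' * z' * Q * ((1 - a * Q ^+ 2) *
    (D' * ((1 - v * U) * (1 - a * v * M * Q)) - N' * ((1 - p * U) * (1 - a * p * M * Q))))
    + - (p * M * (1 - a * v * p * M ^+ 2))
      * (B' * ((1 - Q) * (1 - w * t * Q)
               * (1 - w * b * s * Q + (w * b) ^+ 2 * t * Q ^+ 2)))
      * (z' * ((1 - v * U) * (1 - a * p * M * Q)))).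
    by field.
  by rewrite cert defM; field.
(* The summand k = m.+1 has no counterpart for m; it cancels the boundary term. *)
rewrite big_ord_recr /=; have := telescope _ (leqnn _).
rewrite sumrB -mulr_sumr IHm -prodS => /(canRL (subrK _)) ->.
suff -> : jackson_term m.+1 m.+1 = - G m.+1 by rewrite addrAC subrr add0r.
rewrite /G /jackson_term /tail !subnn !addSn !addnS !poch0 !pochS.
have -> : w * t * p ^+ m.+1 = v * t * M by rewrite /v /M exprS; ring.
have -> : 1 - w * b * s * p ^+ m.+1 + (w * b) ^+ 2 * t * p ^+ m.+1 ^+ 2
   = 1 - v * b * s * M + (v * b) ^+ 2 * t * M ^+ 2 by rewrite /v /M exprS; ring.
have -> : p ^+ m.+1 = p * M by rewrite exprS.
rewrite exprD -/M -/(D) /C.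
have: poch p (a * p) (m + m).+2 != 0 by [].
rewrite !pochS !mulf_eq0 !negb_or exprS exprD -/M => /andP[/andP[x1 x2] x3].
by field; rewrite x1 x2 x3 den_neq ?D_neq.
Qed.
End Jackson.

(** * The terminating q-binomial theorem *)

Section TerminatingBinomial.
Variables (A : idomainType) (p a : A) (m : nat).
Hypothesis apm : a * p ^+ m = 1.
Hypothesis p_neq : forall j, (0 < j <= m)%N -> 1 - p ^+ j != 0.

(* (a;p)_k / (p;p)_k multiplied by (p;p)_m, which keeps it in the ring. *)
Let c k := poch p a k * poch p (p ^+ k.+1) (m - k).

(** The polynomial f of the proof is the q-binomial series
    (p^(-m) y; p)_m up to a constant.  Its functional equation carries the
    zero at y = p^m down to y = p. *)
Lemma qbinomial_root r : (0 < r <= m)%N -> \sum_(k < m.+1) c k * p ^+ r ^+ k = 0.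
Proof.
pose f y := \sum_(k < m.+1) c k * y ^+ k.
have cS k : (k < m)%N -> c k.+1 * (1 - p ^+ k.+1) = c k * (1 - a * p ^+ k).
  move=> ltkm; rewrite /c -(subnSK ltkm) pochS pochSl -exprSr; ring.
have fE y : (1 - y) * f y = (1 - a * y) * f (p * y).
  suff : f y - f (p * y) = y * f y - a * y * f (p * y).
    move/eqP; rewrite -subr_eq0 => /eqP h.
    by apply/eqP; rewrite -subr_eq0 -[X in _ == X]h; apply/eqP; ring.
  transitivity (\sum_(k < m.+1) c k * (1 - p ^+ k) * y ^+ k).
    by rewrite -sumrB; apply: eq_bigr => k _; rewrite exprMn; ring.
  rewrite big_ord_recl expr0 subrr mulr0 mul0r add0r.
  transitivity (\sum_(k < m.+1) c k * (1 - a * p ^+ k) * y ^+ k.+1).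
    rewrite big_ord_recr /= apm subrr mulr0 mul0r addr0.
    by apply: eq_bigr => k _; rewrite cS.
  rewrite !mulr_sumr -sumrB; apply: eq_bigr => k _; rewrite exprMn exprS; ring.
move=> /andP[r_gt0 lerm]; rewrite -/(f _) -(subKn lerm).
have : (m - r < m)%N by rewrite ltn_subrL r_gt0 (leq_trans r_gt0).
elim: (m - r)%N => [|d IHd] ltdm.
  have := fE (p ^+ m); rewrite apm subrr mul0r subn0 => /eqP.
  rewrite mulf_eq0 (negPf (p_neq _)) ?leqnn ?andbT // => /eqP //.
have := fE (p ^+ (m - d.+1)); rewrite -exprS subnSK ?(ltnW ltdm) //.
rewrite IHd ?(ltnW ltdm) // mulr0 => /eqP; rewrite mulf_eq0 (negPf (p_neq _)).
  by move/eqP.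
by rewrite subn_gt0 ltdm leq_subr.
Qed.

Lemma qbinomial_poly (Q : {poly A}) : Q`_0 = 0 -> (size Q <= m.+1)%N ->
  \sum_(k < m.+1) c k * Q.[p ^+ k] = 0.
Proof.
move=> Q0 sQ.
have expand (k : 'I_m.+1) : c k * Q.[p ^+ k] = \sum_(r < m.+1) c k * (Q`_r * p ^+ k ^+ r).
  by rewrite (horner_coef_wide _ sQ) mulr_sumr.
rewrite (eq_bigr _ (fun k _ => expand k)) exchange_big big1 //= => -[[|r] ltrm] _ /=.
  by apply: big1 => k _; rewrite Q0 mul0r mulr0.
transitivity (Q`_r.+1 * \sum_(k < m.+1) c k * p ^+ r.+1 ^+ k).
  by rewrite mulr_sumr; apply: eq_bigr => k _; rewrite mulrCA -!exprM mulnC.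
by rewrite (@qbinomial_root r.+1) ?mulr0.
Qed.
End TerminatingBinomial.

(** * Vanishing of the deformed sum at a root of unity *)

(** Since Y = -X, this is the product of the factors (1 - q^e)^2 - X q^e and
    (1 - q^e)^2 + X q^e, with Z = X^2. *)
Definition quart {A : comPzRingType} (q Z : A) (e : nat) : A :=
  (1 - q ^+ e) ^+ 4 - Z * q ^+ e ^+ 2.

(** The deformed sum multiplied by all its denominators, which makes it a
    polynomial in q and Z that can be evaluated at a root of unity. *)
Definition cleared_sum {A : comPzRingType} (q Z : A) (m : nat) : A :=
  \sum_(k < m.+1) (1 + q * q ^+ 5 ^+ k) * q ^+ 5 ^+ k
    * (poch (q ^+ 5) (q ^+ 2) k * poch (q ^+ 5) (q ^+ 5 ^+ k.+1) (m - k))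
    * (\prod_(i < k) quart q Z (5 * i + 2) * \prod_(k <= i < m) quart q Z (5 * i + 5)).

(** Both sides are P (r + k) * P m / (P r * P k) for the partial products P
    of g: two runs of factors, one growing and one shrinking with k, are
    traded for a constant and a window of fixed length. *)
Lemma window_prod {A : idomainType} (g : nat -> A) k r m :
  (forall i, g i != 0) -> (k <= m)%N -> (r <= m)%N ->
  \prod_(i < k) g (r + i)%N * \prod_(k <= i < m) g i =
  \prod_(r <= i < m) g i * \prod_(i < r) g (k + i)%N.
Proof.
move=> g_neq lekm lerm; pose P j := \prod_(0 <= i < j) g i.
have P_neq j : P j != 0 by rewrite prodf_seq_neq0; apply/allP => i _; apply: g_neq.
have split_at i j : (i <= j)%N -> P j = P i * \prod_(i <= l < j) g l.
  by move=> leij; rewrite -big_cat_nat.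
have shift i j : P (i + j)%N = P i * \prod_(l < j) g (i + l)%N.
  rewrite (split_at i) ?leq_addr // -{2}[i]add0n big_addn addKn big_mkord.
  by congr (_ * _); apply: eq_bigr => l _; rewrite addnC.
apply: (mulfI (mulf_neq0 (P_neq r) (P_neq k))).
by rewrite [LHS]mulrACA [RHS]mulrACA -!shift -!split_at // addnC mulrC.
Qed.

(** As 5 i + 2 + n = 5 (i + r + 1), the numerator factors are the denominator
    factors shifted by r, so [window_prod] applies; what is left is the
    polynomial Q evaluated at q^(5k). Its degree 4 r + 2 is exactly m, the
    largest one that [qbinomial_poly] allows. *)
Lemma cleared_sum_root {A : idomainType} (q Z : A) r :
  q ^+ (5 * r + 3) = 1 ->
  (forall j, (0 < j <= 4 * r + 2)%N -> 1 - q ^+ 5 ^+ j != 0) ->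
  (forall e, quart q Z e != 0) ->
  cleared_sum q Z (4 * r + 2) = 0.
Proof.
set n := (5 * r + 3)%N; set m := (4 * r + 2)%N => qn p_neq quart_neq.
set p := q ^+ 5.
pose fac i : {poly A} := (1 - (p ^+ i.+1)%:P * 'X) ^+ 4 - (Z * p ^+ i.+1 ^+ 2)%:P * 'X^2.
pose Q : {poly A} := (1 + q%:P * 'X) * 'X * \prod_(i < r) fac i.
have quartE i k : quart q Z (5 * (k + i.+1)) = (fac i).[p ^+ k].
  have pE : q ^+ (5 * (k + i.+1)) = p ^+ i.+1 * p ^+ k by rewrite exprM -/p -exprD addnC.
  by rewrite /quart /fac pE !(hornerE, hornerXn) /=; ring.
have Q0 : Q`_0 = 0 by rewrite -horner_coef0 /Q !hornerE.
have sQ : (size Q <= m.+1)%N.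
  have sM (P R : {poly A}) d e : (size P <= d.+1)%N -> (size R <= e.+1)%N ->
      (size (P * R)%R <= (d + e).+1)%N.
    by move=> sP sR; apply: leq_trans (size_polyMleq _ _) _; move: sP sR; lia.
  have sB (P R : {poly A}) d : (size P <= d)%N -> (size R <= d)%N ->
      (size (P - R)%R <= d)%N.
    move=> sP sR; apply: leq_trans (size_polyD _ _) _.
    by rewrite size_polyN geq_max sP sR.
  have sCX (c : A) : (size (c%:P * 'X)%R <= 2)%N.
    by apply: (sM _ _ 0 1); rewrite ?size_polyX ?size_polyC_leq1.
  have s_fac i : (size (fac i) <= 5)%N.
    apply: (sB).
      apply: leq_trans (size_poly_exp_leq _ _) _; rewrite ltnS.
      have : (size (1 - (p ^+ i.+1)%:P * 'X)%R <= 2)%N by rewrite sB ?sCX ?size_poly1.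
      by case: (size _) => [|[|[]]].
    by apply: (sM _ _ 0 4); rewrite ?size_polyXn ?size_polyC_leq1.
  have s_prod : (size (\prod_(i < r) fac i)%R <= (4 * r).+1)%N.
    elim: {+}r => [|d IHd]; first by rewrite big_ord0 size_polyC oner_neq0.
    by rewrite big_ord_recr mulnS addnC; apply: (sM).
  have -> : m.+1 = (1 + 1 + 4 * r).+1 by rewrite /m; lia.
  rewrite !sM ?size_polyX // -[q%:P * 'X]opprK sB ?size_poly1 //.
  by rewrite size_polyN sCX.
have apm : q ^+ 2 * p ^+ m = 1.
  rewrite /p -exprM -exprD; have -> : (2 + 5 * m = n * 4)%N by rewrite /n /m; lia.
  by rewrite (exprM q n 4) qn expr1n.
pose g i := quart q Z (5 * i + 5).
have g_shift i : quart q Z (5 * i + 2) = g (r + i)%N.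
  rewrite /g /quart; have -> : (5 * (r + i) + 5 = n + (5 * i + 2))%N by rewrite /n; lia.
  by rewrite (exprD q n) qn mul1r.
have lerm : (r <= m)%N by rewrite /m; lia.
have := @qbinomial_poly _ _ _ _ apm p_neq _ Q0 sQ.
move/(congr1 ( *%R (\prod_(r <= i < m) g i))); rewrite mulr0 => <-.
rewrite mulr_sumr; apply: eq_bigr => -[k ltkm] _ /=.
have -> : \prod_(i < k) quart q Z (5 * i + 2) = \prod_(i < k) g (r + i)%N.
  by apply: eq_bigr => i _; rewrite g_shift.
rewrite -/p (@window_prod _ g) // => [|i]; last exact: quart_neq.
have -> : \prod_(i < r) g (k + i)%N = (\prod_(i < r) fac i).[p ^+ k].
  rewrite horner_prod; apply: eq_bigr => i _; rewrite -quartE /g.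
  by congr quart; lia.
rewrite /Q !hornerE /=; ring.
Qed.

(** * The local ring at a cyclotomic polynomial *)

Local Notation "p %:F" := (@FracField.tofrac {poly int} p).

Section LocalRing.
Variables (n : nat) (zeta : algC).
Hypothesis prim_zeta : n.-primitive_root zeta.

Definition at_zeta : {poly int} -> algC :=
  horner_eval zeta \o map_poly (intr : int -> algC).
HB.instance Definition _ := GRing.RMorphism.on at_zeta.

(** 'Phi_n is the minimal polynomial of z over the rationals; it is primitive,
    so divisibility descends to integer coefficients. *)
Lemma prim_root_dvd (z : algC) (U : {poly int}) : n.-primitive_root z ->
  root (map_poly intr U) z -> 'Phi_n %| U.
Proof.
move=> prim_z.
have [f [Df _] dv_f] := minCpolyP z.
have ratrE (P : {poly int}) :
    map_poly (ratr : rat -> algC) (map_poly intr P) = map_poly intr P.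
  by rewrite -map_poly_comp; apply: eq_map_poly => c /=; rewrite ratr_int.
have Ef : f = map_poly intr 'Phi_n.
  apply: (map_poly_inj (ratr : {rmorphism rat -> algC})).
  by rewrite -Df (minCpoly_cyclotomic prim_z) ratrE (Cintr_Cyclotomic prim_z).
by rewrite -ratrE dv_f Ef dvdp_rat_int.
Qed.

Lemma at_zeta_Phi : at_zeta 'Phi_n = 0.
Proof.
rewrite /at_zeta /= (Cintr_Cyclotomic prim_zeta) /horner_eval.
by apply/eqP; rewrite -/(root _ _) root_cyclotomic.
Qed.

Lemma at_zeta_eq0 U : at_zeta U = 0 -> exists U', U = 'Phi_n * U'.
Proof.
move=> /eqP U0; have /dvdpP_int[U' ->] := prim_root_dvd prim_zeta U0.
by exists U'; rewrite zprimitive_monic ?Cyclotomic_monic.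
Qed.

(** A common factor of positive degree would have a complex root.  Being a
    root of 'Phi_n it is a primitive n-th root of unity, so 'Phi_n would
    divide V. *)
Lemma coprime_Phi V : at_zeta V != 0 -> coprimep V 'Phi_n.
Proof.
apply: contraNT => /negPf; rewrite /coprimep => ncop.
pose h := map_poly (intr : int -> algC).
have szh P : size (h P) = size P by apply: size_map_inj_poly => //; apply: intr_inj.
have /closed_rootP[x xD] : size (h (gcdp V 'Phi_n)) != 1 by rewrite szh ncop.
have rootD P : gcdp V 'Phi_n %| P -> root (h P) x.
  case/Pdiv.Idomain.dvdpP => -[c s] /= c0 cP.
  have := congr1 h cP; rewrite /h map_polyZ rmorphM /= -/h => hP.
  have : root (c%:~R *: h P) x by rewrite hP rootM xD orbT.
  by rewrite rootZ // intr_eq0.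
have prim_x : n.-primitive_root x.
  by rewrite -(root_cyclotomic prim_zeta) -(Cintr_Cyclotomic prim_zeta) rootD ?dvdp_gcdr.
have /dvdpP_int[U' ->] := prim_root_dvd prim_x (rootD _ (dvdp_gcdl _ _)).
by rewrite rmorphM zprimitive_monic ?Cyclotomic_monic //= at_zeta_Phi mul0r.
Qed.

(** Order of vanishing at least j along 'Phi_n; for j = 0 this is membership in
    the localization. *)
Definition vanish (j : nat) (x : ratfrac) : Prop :=
  exists U V, at_zeta V != 0 /\ x = ('Phi_n ^+ j * U)%:F / V%:F.

Definition local_unit (x : ratfrac) : Prop :=
  exists U V, [/\ at_zeta U != 0, at_zeta V != 0 & x = U%:F / V%:F].

Lemma neq0_at_zeta V : at_zeta V != 0 -> V%:F != 0.
Proof. by apply: contraNneq => /eqP; rewrite tofrac_eq0 => /eqP ->; rewrite rmorph0. Qed.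

Lemma vanish_congr F G : vanish 5 (F - G) -> congr_Phi n 5 F G.
Proof.
case=> U [V] [V0 FG]; exists ('Phi_n ^+ 5 * U), V; split=> //.
- by apply: contraNneq V0 => ->; rewrite rmorph0.
- exact: coprime_Phi.
- exact: dvdp_mulr.
Qed.

Lemma vanishM i j x y : vanish i x -> vanish j y -> vanish (i + j) (x * y).
Proof.
case=> U [V] [V0 ->] [U'] [V'] [V0' ->]; exists (U * U'), (V * V').
split; first by rewrite rmorphM mulf_neq0.
by rewrite !rmorphM exprD /= rmorphM invfM mulrACA; congr (_ * _); rewrite mulrACA.
Qed.

Lemma vanishD j x y : vanish j x -> vanish j y -> vanish j (x + y).
Proof.
case=> U [V] [V0 ->] [U'] [V'] [V0' ->]; exists (U * V' + U' * V), (V * V').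
split; first by rewrite rmorphM mulf_neq0.
rewrite addf_div ?neq0_at_zeta // -!rmorphM -rmorphD mulrDr.
by rewrite !mulrA.
Qed.

Lemma vanish_poly U : vanish 0 U%:F.
Proof. by exists U, 1; rewrite rmorph1 oner_neq0 mul1r rmorph1 divr1. Qed.

Lemma vanish_poly1 U : at_zeta U = 0 -> vanish 1 U%:F.
Proof.
case/at_zeta_eq0=> U' ->; exists U', 1.
by rewrite rmorph1 oner_neq0 rmorph1 divr1.
Qed.

Lemma vanish0 j : vanish j 0.
Proof. by exists 0, 1; rewrite rmorph1 oner_neq0 mulr0 rmorph0 mul0r. Qed.

Lemma vanish_one : vanish 0 1.
Proof. by rewrite -(rmorph1 (@FracField.tofrac {poly int})); apply: vanish_poly. Qed.

Lemma vanishMr j x y : vanish j x -> vanish 0 y -> vanish j (x * y).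
Proof. by move=> xj y0; rewrite -[j]addn0; apply: vanishM. Qed.

Lemma vanishMl j x y : vanish 0 x -> vanish j y -> vanish j (x * y).
Proof. exact: (@vanishM 0). Qed.

Lemma vanishN j x : vanish j x -> vanish j (- x).
Proof.
move=> xj; rewrite -mulN1r; apply: vanishMl xj.
by rewrite -[1](rmorph1 (@FracField.tofrac {poly int})) -rmorphN; apply: vanish_poly.
Qed.

Lemma vanishB j x y : vanish j x -> vanish j y -> vanish j (x - y).
Proof. by move=> xj yj; apply/vanishD/vanishN. Qed.

Lemma vanishX i x k : vanish i x -> vanish (k * i) (x ^+ k).
Proof.
move=> xi; elim: k => [|k IHk]; first exact: vanish_one.
by rewrite exprS mulSn; apply: vanishM.
Qed.

Lemma vanish_sum (I : Type) (s : seq I) (P : pred I) (E : I -> ratfrac) j :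
  (forall i, P i -> vanish j (E i)) -> vanish j (\sum_(i <- s | P i) E i).
Proof. by move=> Ej; elim/big_ind: _ => //; [apply: vanish0 | apply: vanishD]. Qed.

Lemma vanish_leq i j x : (i <= j)%N -> vanish j x -> vanish i x.
Proof.
move=> leij [U] [V] [V0 ->]; exists ('Phi_n ^+ (j - i) * U), V.
by rewrite mulrA -exprD subnKC.
Qed.

Lemma unit_vanish x : local_unit x -> vanish 0 x.
Proof. by case=> U [V] [_ V0 ->]; exists U, V; rewrite mul1r. Qed.

Lemma unit_neq0 x : local_unit x -> x != 0.
Proof. by case=> U [V] [U0 V0 ->]; rewrite mulf_neq0 ?invr_eq0 ?neq0_at_zeta. Qed.

Lemma unitV x : local_unit x -> local_unit x^-1.
Proof. by case=> U [V] [U0 V0 ->]; exists V, U; rewrite invf_div. Qed.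

Lemma unitM x y : local_unit x -> local_unit y -> local_unit (x * y).
Proof.
case=> U [V] [U0 V0 ->] [U'] [V'] [U0' V0' ->]; exists (U * U'), (V * V').
by rewrite !rmorphM !mulf_neq0 // /= invfM mulrACA.
Qed.

Lemma unit_poly U : at_zeta U != 0 -> local_unit U%:F.
Proof. by move=> U0; exists U, 1; rewrite !rmorph1 oner_neq0 divr1. Qed.

Lemma unit_prod (I : Type) (s : seq I) (P : pred I) (E : I -> ratfrac) :
  (forall i, P i -> local_unit (E i)) -> local_unit (\prod_(i <- s | P i) E i).
Proof.
move=> Eu; elim/big_ind: _ => //; last exact: unitM.
by rewrite -(rmorph1 (@FracField.tofrac {poly int})); apply: unit_poly; rewrite rmorph1 oner_neq0.
Qed.

Lemma unitD x y : local_unit x -> vanish 1 y -> local_unit (x + y).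
Proof.
case=> U [V] [U0 V0 ->] [U'] [V'] [V0' ->].
exists (U * V' + 'Phi_n ^+ 1 * U' * V), (V * V'); split.
- by rewrite expr1 rmorphD !rmorphM /= at_zeta_Phi !mul0r addr0 mulf_neq0.
- by rewrite rmorphM mulf_neq0.
- by rewrite addf_div ?neq0_at_zeta // -!rmorphM -rmorphD.
Qed.

Lemma vanish_prod0 (I : Type) (s : seq I) (P : pred I) (E : I -> ratfrac) :
  (forall i, P i -> vanish 0 (E i)) -> vanish 0 (\prod_(i <- s | P i) E i).
Proof.
by move=> Eu; elim/big_ind: _ => //; [apply: vanish_one | apply: (@vanishM 0 0)].
Qed.

(** Replacing the factors one at a time. *)
Lemma vanish_prodB (I : Type) (s : seq I) (P : pred I) (E E' : I -> ratfrac) j :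
  (forall i, P i -> vanish 0 (E i)) -> (forall i, P i -> vanish 0 (E' i)) ->
  (forall i, P i -> vanish j (E i - E' i)) ->
  vanish j (\prod_(i <- s | P i) E i - \prod_(i <- s | P i) E' i).
Proof.
move=> E0 E0' EB; elim: s => [|i s IHs]; first by rewrite !big_nil subrr; apply: vanish0.
rewrite !big_cons; case: ifP => // Pi.
set A := \prod_(_ <- _ | _) _; set B := \prod_(_ <- _ | _) _.
have -> : E i * A - E' i * B = (E i - E' i) * A + E' i * (A - B) by ring.
apply: vanishD; first by apply: vanishMr (EB _ Pi) _; apply: vanish_prod0.
by apply: vanishMl (E0' _ Pi) IHs.
Qed.

(** The gain of one order: all coefficients of W vanish at zeta, and each term
    of the difference contains z. *)
Lemma vanish_horner (W : {poly {poly int}}) j z :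
  map_poly at_zeta W = 0 -> vanish j z ->
  vanish j.+1 ((map_poly (@FracField.tofrac {poly int}) W).[z]
               - (map_poly (@FracField.tofrac {poly int}) W).[0]).
Proof.
move=> W0 zj; rewrite horner_coef0.
have coefW i : vanish 1 (map_poly (@FracField.tofrac {poly int}) W)`_i.
  rewrite coef_map; apply: vanish_poly1.
  by rewrite -coef_map W0 coef0.
rewrite (horner_coef_wide _ (leqnSn _)) big_ord_recl mulr1 addrC addKr.
apply: vanish_sum => i _; apply: (@vanishM 1); first exact: coefW.
rewrite exprS; apply: (vanishMr zj); rewrite -(muln0 i); apply: vanishX.
exact: (vanish_leq (leq0n j) zj).
Qed.
End LocalRing.

(** * The deformed sum over a field *)

(** F(X, -X) as a function of z = X^2. *)
Definition deformed_sum {K : fieldType} (q z : K) (m : nat) : K :=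
  \sum_(k < m.+1) (1 + q * q ^+ 5 ^+ k) * q ^+ 5 ^+ k / (1 + q)
    * (poch (q ^+ 5) (q ^+ 2) k / poch (q ^+ 5) (q ^+ 5) k)
    * (\prod_(i < k) quart q z (5 * i + 2) / \prod_(i < k) quart q z (5 * i + 5)).

Section NonTorsion.
Variables (K : fieldType) (q : K).
Hypothesis q_neq0 : q != 0.
Hypothesis qX_neq1 : forall e, (0 < e)%N -> 1 - q ^+ e != 0.

Lemma onePq_neq0 : 1 + q != 0.
Proof.
have := @qX_neq1 2 isT; have -> : 1 - q ^+ 2 = (1 - q) * (1 + q) by ring.
by rewrite mulf_eq0 negb_or => /andP[].
Qed.

Lemma poch_q_neq0 e k : (0 < e)%N -> poch (q ^+ 5) (q ^+ e) k != 0.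
Proof.
by move=> e_gt0; rewrite poch_qE; apply/prodf_neq0 => i _; rewrite qX_neq1 // addn_gt0 e_gt0 orbT.
Qed.

Lemma cleared_sumE z m : (forall i, (i < m)%N -> quart q z (5 * i + 5) != 0) ->
  cleared_sum q z m =
    (1 + q) * poch (q ^+ 5) (q ^+ 5) m * \prod_(i < m) quart q z (5 * i + 5) * deformed_sum q z m.
Proof.
move=> qz_neq; rewrite /deformed_sum mulr_sumr; apply: eq_bigr => -[k ltkm] _ /=.
have lekm : (k <= m)%N by [].
have -> : poch (q ^+ 5) (q ^+ 5) m
    = poch (q ^+ 5) (q ^+ 5) k * poch (q ^+ 5) (q ^+ 5 ^+ k.+1) (m - k).
  by rewrite -{1}(subnKC lekm) poch_cat -exprS.
rewrite -[\prod_(i < m) _](big_mkord xpredT (fun i => quart q z (5 * i + 5))).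
rewrite (big_cat_nat (leq0n k) lekm) /= big_mkord.
have x1 := onePq_neq0; have x2 := @poch_q_neq0 5 k isT.
have x3 : \prod_(i < k) quart q z (5 * i + 5) != 0.
  by apply/prodf_neq0 => i _; rewrite qz_neq // (leq_trans (ltn_ord i)).
by field; rewrite x1 x2 x3.
Qed.

(** The first two factors are the pair x = y, 1/y that deforms in X; the last
    one is the conjugate pair that deforms in Y = -X. *)
Lemma quart_split y e : y != 0 -> let T := (1 - y) ^+ 2 / y in
  quart q (T ^+ 2) e
    = (1 - y * q ^+ e) * (1 - y^-1 * q ^+ e) * (1 - (2 - T) * q ^+ e + q ^+ e ^+ 2).
Proof. by move=> y0; rewrite /quart /=; field. Qed.

Section JacksonSpecialization.
Variable m : nat.
Let p := q ^+ 5.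
Let t := q ^+ 2 * p ^+ m.
Let T := (1 - t) ^+ 2 / t.
Hypothesis quart_neq : forall i, (i < m)%N -> quart q (T ^+ 2) (5 * i + 5) != 0.

Lemma t_neq0 : t != 0.
Proof. by rewrite mulf_neq0 ?expf_neq0 ?q_neq0. Qed.

Let tail i j := poch p (q ^+ 2) i * poch p (q ^+ 4) j / (poch p p i * poch p (q ^+ 7) j).

Lemma quart_prod e k : \prod_(i < k) quart q (T ^+ 2) (5 * i + e) =
  poch p (q ^+ e * t) k * poch p (q ^+ e / t) k * poch2 p (q ^+ e * (2 - T)) (q ^+ e ^+ 2) k.
Proof.
rewrite -!big_split; apply: eq_bigr => i _ /=; rewrite quart_split ?t_neq0 // -/T.
rewrite exprD exprM -/p; congr (_ * _ * _); ring.
Qed.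

Lemma quart_factors_neq0 k : (k <= m)%N ->
  [/\ poch p (p * t) k != 0, poch p (p / t) k != 0 & poch2 p (p * (2 - T)) (p ^+ 2) k != 0].
Proof.
move=> lekm; apply/and3P; rewrite andbA -!negb_or -!mulf_eq0 -quart_prod.
by apply/prodf_neq0 => i _; apply/quart_neq/(leq_trans (ltn_ord i)).
Qed.

(** Turns the factorials of lengths m - k and m + k of Jackson's sum into the
    factors of the deformed sum at x = t, where q^2 / t = p^(-m). *)
Lemma tailE k : (k <= m)%N ->
  tail (m - k) (m + k) / q ^+ 3 ^+ k
  = tail m m * (poch p (q ^+ 2 * t) k * poch p (q ^+ 2 / t) k
                / (poch p (p * t) k * poch p (p / t) k)).
Proof.
elim: k => [|k IHk] lekm; first by rewrite subn0 addn0 !poch0 expr0 !mulr1 !divr1 mulr1.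
have [x1 x2 _] := quart_factors_neq0 (ltnW lekm).
have [] := quart_factors_neq0 lekm; rewrite !pochS !mulf_eq0 !negb_or.
move=> /andP[_ x3] /andP[_ x4] _.
have step : tail (m - k.+1) (m + k.+1) / q ^+ 3 ^+ k.+1 = tail (m - k) (m + k) / q ^+ 3 ^+ k
   * ((1 - q ^+ 2 * t * p ^+ k) * (1 - q ^+ 2 / t * p ^+ k)
      / ((1 - p * t * p ^+ k) * (1 - p / t * p ^+ k))).
  have [d mE] : exists d, m = (d + k.+1)%N by exists (m - k.+1)%N; rewrite subnK.
  have mkE : (m - k = d.+1)%N by rewrite mE; lia.
  have mkE' : (m - k.+1 = d)%N by rewrite mE; lia.
  have y1 := @poch_q_neq0 5 d isT; have y2 := @poch_q_neq0 7 (m + k)%N isT.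
  have y3 : 1 - p * p ^+ d != 0 by rewrite /p -exprM -exprD qX_neq1.
  have y4 : 1 - q ^+ 2 * p ^+ d != 0 by rewrite /p -exprM -exprD qX_neq1.
  have z0 : p ^+ d != 0 by rewrite !expf_neq0.
  have z1 : p ^+ k != 0 by rewrite !expf_neq0.
  have z2 : (q ^+ 3) ^+ k != 0 by rewrite !expf_neq0.
  move: x3 x4 y1 y2; rewrite /tail mkE mkE' addnS !pochS /t (exprS (q ^+ 3)) exprD mE !exprD.
  rewrite (exprS p) /p; rewrite /p in y3 y4 z0 z1.
  move: y3 y4 z0 z1 z2.
  set P := q ^+ 5 ^+ d; set R := q ^+ 5 ^+ k; set S := q ^+ 3 ^+ k.
  move=> y3 y4 z0 z1 z2 x3 x4 y1 y2.
  have y5 : P * q ^+ 2 - 1 != 0 by rewrite -oppr_eq0 opprB mulrC.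
  by field; rewrite z0 z1 z2 q_neq0 x3 y1 y2 y3 y5.
rewrite step IHk ?(ltnW lekm) // -mulrA mulf_div; congr (_ * (_ / _)); exact: mulrACA.
Qed.

(** Jackson's sum with a = q^2, b = q, c d = q^4, c + d = q^2 (2 - T), for which
    w = q^(-3) and v = q^2. As b is a square root of a, the factor
    (b;p)_k / (a p/b;p)_k turns 1 - a p^(2k) into a multiple of 1 + q p^k. *)
Lemma deformed_sum_product :
  deformed_sum q (T ^+ 2) m =
  poch p (q ^+ 3) m * poch p (q ^+ 7) m * poch2 p (q ^+ 4 * (2 - T)) (q ^+ 4 ^+ 2) m
  / (poch p (q ^+ 2) m * poch p (q ^+ 6) m * poch2 p (p * (2 - T)) (p ^+ 2) m).
Proof.
have p_neq k : 1 - p ^+ k.+1 != 0 by rewrite /p -exprM qX_neq1.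
pose w := (q ^+ 3)^-1.
have wp : w * p = q ^+ 2 by rewrite /w /p; field.
have wqq : w * q * q ^+ 4 = q ^+ 2 by rewrite /w; field.
have q2q4 : q ^+ 2 * q ^+ 4 = q ^+ 6 by rewrite -exprD.
have q2p : q ^+ 2 * p = q ^+ 7 by rewrite /p -exprD.
have sE : q ^+ 2 * q * (q ^+ 2 * (2 - T)) = p * (2 - T) by rewrite /p; ring.
have tE : (q ^+ 2 * q) ^+ 2 * q ^+ 4 = p ^+ 2 by rewrite /p; ring.
have J : \sum_(k < m.+1) jackson_term p w q (q ^+ 2 * (2 - T)) (q ^+ 4) m k =
    jackson_prod p w q (q ^+ 2 * (2 - T)) (q ^+ 4) m.
  apply: jackson_sum => [//|k|k|k ltkm].
  - by rewrite wqq /p -exprM -exprD qX_neq1.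
  - by rewrite wp q2q4 /p -exprM -exprD qX_neq1.
  - have [_ _] := quart_factors_neq0 ltkm.
    by rewrite wp sE tE poch2S mulf_eq0 negb_or => /andP[].
have termE k : (k <= m)%N -> jackson_term p w q (q ^+ 2 * (2 - T)) (q ^+ 4) m k =
   (1 - q ^+ 2) * tail m m * ((1 + q * p ^+ k) * p ^+ k / (1 + q)
    * (poch p (q ^+ 2) k / poch p p k)
    * (\prod_(i < k) quart q (T ^+ 2) (5 * i + 2) / \prod_(i < k) quart q (T ^+ 2) (5 * i + 5))).
  move=> lekm; rewrite /jackson_term wqq wp q2q4 sE tE !quart_prod.
  have -> : q ^+ 2 * q ^+ 2 = q ^+ 4 by rewrite -exprD.
  rewrite q2p -/(tail (m - k) (m + k)).
  have -> : q ^+ 2 ^+ 2 = q ^+ 4 by rewrite -exprM.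
  have [x1 x2 x3] := quart_factors_neq0 lekm.
  have tailE' : tail (m - k) (m + k) = q ^+ 3 ^+ k * tail m m
      * (poch p (q ^+ 2 * t) k * poch p (q ^+ 2 / t) k
         / (poch p (p * t) k * poch p (p / t) k)).
    by rewrite -mulrA -tailE // mulrC divfK // !expf_neq0.
  have bE : poch p q k * (1 - q * p ^+ k) = (1 - q) * poch p (q ^+ 6) k.
    by rewrite -pochS pochSl /p -exprS.
  have y1 : 1 - q * p ^+ k != 0 by rewrite /p -exprM -exprS qX_neq1.
  have y2 : q ^+ 3 ^+ k != 0 by rewrite !expf_neq0.
  have y3 := @poch_q_neq0 5 k isT; have y4 := @poch_q_neq0 6 k isT; have y5 := onePq_neq0.
  rewrite tailE' /w exprVn (canRL (mulfK y1) bE) -/p; rewrite -/p in y3 y4.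
  set P := p ^+ k in y1 *; set S := q ^+ 3 ^+ k in y2 *.
  by field; rewrite ?y1 ?y2 ?y3 ?y4 ?y5 ?x1 ?x2 ?x3.
move: J; rewrite (eq_bigr _ (fun (k : 'I_m.+1) _ => termE k (ltn_ord k))).
rewrite -mulr_sumr -/(deformed_sum q (T ^+ 2) m).
have z1 := @poch_q_neq0 2 m isT; have z2 := @poch_q_neq0 4 m isT.
have z3 := @poch_q_neq0 5 m isT; have z4 := @poch_q_neq0 7 m isT.
have z5 := @poch_q_neq0 6 m isT; have z6 := @qX_neq1 2 isT.
have [_ _ z7] := quart_factors_neq0 (leqnn m).
have h : (1 - q ^+ 2) * tail m m != 0.
  by rewrite /tail !mulf_neq0 ?invr_eq0 // mulf_neq0.
move/(canRL (mulKf h)) ->; rewrite /jackson_prod /tail wqq wp q2q4 sE tE.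
have -> : q ^+ 2 * q ^+ 2 = q ^+ 4 by rewrite -exprD.
have -> : q ^+ 2 * q = q ^+ 3 by rewrite -exprSr.
have -> : q ^+ 2 * (q ^+ 2 * (2 - T)) = q ^+ 4 * (2 - T) by ring.
have -> : q ^+ 2 ^+ 2 * q ^+ 4 = q ^+ 4 ^+ 2 by ring.
rewrite -/p in z1 z2 z3 z4 z5.
set A1 := poch p (q ^+ 2) m in z1 *; set A2 := poch p (q ^+ 4) m in z2 *.
set A3 := poch p p m in z3 *; set A4 := poch p (q ^+ 7) m in z4 *.
set A5 := poch p (q ^+ 6) m in z5 *.
by field; rewrite z1 z2 z3 z4 z5 z6 z7.
Qed.
End JacksonSpecialization.

Lemma deformed_sum0 m : deformed_sum q 0 m =
  \sum_(k < m.+1) (1 + q ^+ (5 * k + 1)) * poch (q ^+ 5) (q ^+ 2) k ^+ 5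
      / ((1 + q) * poch (q ^+ 5) (q ^+ 5) k ^+ 5) * q ^+ (5 * k).
Proof.
have quart0 e k : \prod_(i < k) quart q 0 (5 * i + e) = poch (q ^+ 5) (q ^+ e) k ^+ 4.
  by rewrite poch_qE -prodrXl; apply: eq_bigr => i _; rewrite /quart mul0r subr0.
apply: eq_bigr => k _; rewrite !quart0 addn1 (exprS q (5 * k)) !exprM.
have := onePq_neq0; have := @poch_q_neq0 5 k isT.
set A := poch _ (q ^+ 2) k; set B := poch _ _ k; set P := q ^+ 5 ^+ k => B0 q1.
by field; rewrite B0 q1.
Qed.
End NonTorsion.

(** * Comparison of products *)

Section Algebra.
Variable K : fieldType.
Implicit Types q x y T : K.

(** (1 - q^e y)(1 - q^e/y) for y + 1/y = 2 - T, that is, for Y = -T. *)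
Definition quad q T e := (1 - q ^+ e) ^+ 2 + T * q ^+ e.

Lemma poch2_quad q T e k :
  poch2 (q ^+ 5) (q ^+ e * (2 - T)) (q ^+ e ^+ 2) k = \prod_(i < k) quad q T (5 * i + e).
Proof. by apply: eq_bigr => i _; rewrite /quad exprD exprM; ring. Qed.

Lemma poch_sqr q e k : poch (q ^+ 5) (q ^+ e) k ^+ 2 = \prod_(i < k) quad q 0 (5 * i + e).
Proof.
by rewrite poch_qE -prodrXl; apply: eq_bigr => i _; rewrite /quad mul0r addr0.
Qed.

(** The source of the factor 1 + [4n]^2 q^(-n)/[3n]^2, with x = q^(3n),
    y = q^n and c = 1 - q. *)
Lemma quad_factor (c x y : K) : c != 0 -> 1 - x != 0 -> x != 0 -> y != 0 ->
  (1 - x) ^+ 2 + (1 - x * y) ^+ 2 / (x * y) * x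
  = (1 - x) ^+ 2 * (1 + ((1 - x * y) / c) ^+ 2 * y^-1 / ((1 - x) / c) ^+ 2).
Proof. by move=> c0 x1 x0 y0; field; rewrite c0 x1 x0 y0. Qed.

Lemma sum_diff (E D0 D1 V0 V1 : K) : E != 0 -> D0 != 0 ->
  V0 - V1 = - (E * D1 * V1 - E * D0 * V0 - E * (D1 - D0) * V1) / (E * D0).
Proof. by move=> E0 D00; field; rewrite E0 D00. Qed.

(** The factor common to both products is split off; what remains is a
    difference of quotients of units. *)
Lemma prod_diff (A2 A3 A4 A5 A6 A7 k0 k1 u N0 N1 L0 L1 : K) :
  A2 != 0 -> A6 != 0 -> L0 != 0 -> L1 != 0 ->
  A4 ^+ 2 = k0 * N0 -> A5 ^+ 2 = L0 -> k1 = k0 * u ->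
  A3 * A7 * (k1 * N1) / (A2 * A6 * L1)
    - A3 * (A4 * (A4 * (A7 * 1))) / (A2 * (A5 * (A5 * (A6 * 1)))) * u
  = A7 / A6 * (A3 / A2) * (k1 * (((N1 - N0) * L0 - N0 * (L1 - L0)) / (L1 * L0))).
Proof.
move=> x2 x6 y0 y1 E4 E5 ->.
have -> : A3 * (A4 * (A4 * (A7 * 1))) = A3 * A7 * A4 ^+ 2 by ring.
have -> : A2 * (A5 * (A5 * (A6 * 1))) = A2 * A6 * A5 ^+ 2 by ring.
by rewrite E4 E5; field; rewrite x2 x6 y0 y1.
Qed.

Lemma one_minus_sqr_div (x a b : K) : 1 - x != 0 ->
  (1 - x ^+ 2) * a / ((1 - x) * b) = (1 + x) * a / b.
Proof.
move=> x0; have -> : 1 - x ^+ 2 = (1 - x) * (1 + x) by ring.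
by rewrite -(mulrA (1 - x)) -mulf_div divff // mul1r.
Qed.

Lemma frac_regroup (a b c d e f g : K) :
  a * b * (c * d) / (e * f * g) = b / f * (a / e) * (c * (d / g)).
Proof. rewrite !invfM; ring. Qed.
End Algebra.

(** * Assembling the congruence *)

Local Notation q := qvar.

Lemma qvar_neq0 : q != 0.
Proof. by rewrite tofrac_eq0 polyX_eq0. Qed.

Lemma q_frac e : 1 - q ^+ e = (1 - 'X^e)%:F.
Proof. by rewrite rmorphB rmorph1 rmorphXn. Qed.

Lemma qvarX_neq1 e : (0 < e)%N -> 1 - q ^+ e != 0.
Proof.
move=> e_gt0; rewrite q_frac tofrac_eq0 -size_poly_eq0 -opprB size_polyN.
by rewrite size_XnsubC.
Qed.

Section Main.
Variables (r : nat) (zeta : algC).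
Let n := (5 * r + 3)%N.
Let m := (4 * r + 2)%N.
Hypothesis prim_zeta : n.-primitive_root zeta.
Local Notation vanish := (vanish n zeta).
Local Notation unit := (local_unit zeta).

Lemma at_zetaX : at_zeta zeta 'X = zeta.
Proof. by rewrite /at_zeta /= map_polyX /horner_eval hornerX. Qed.

Lemma at_zeta_1X e : at_zeta zeta (1 - 'X^e) = 1 - zeta ^+ e.
Proof.
by rewrite rmorphB rmorph1 rmorphXn /= at_zetaX.
Qed.

Lemma unit_1q e : ~~ (n %| e)%N -> unit (1 - q ^+ e).
Proof.
move=> nd; rewrite q_frac; apply: unit_poly; rewrite at_zeta_1X.
by rewrite subr_eq0 eq_sym -(prim_order_dvd prim_zeta).
Qed.

Lemma vanish_1q e : (n %| e)%N -> vanish 1 (1 - q ^+ e).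
Proof.
rewrite (prim_order_dvd prim_zeta) q_frac => /eqP ze.
by apply: vanish_poly1 => //; rewrite at_zeta_1X ze subrr.
Qed.

Lemma vanish_1q0 e : vanish 0 (1 - q ^+ e).
Proof. by rewrite q_frac; apply: vanish_poly. Qed.

Lemma unit_q e : unit (q ^+ e).
Proof.
rewrite -rmorphXn; apply: unit_poly.
rewrite rmorphXn /= at_zetaX expf_neq0 //.
by rewrite (prim_root_eq0 prim_zeta) /n addn_eq0 andbF.
Qed.

Lemma vanish_q e : vanish 0 (q ^+ e).
Proof. exact/unit_vanish/unit_q. Qed.

Lemma not_dvd e : (e < 5 * n)%N ->
  [&& e != 0, e != n, e != 2 * n, e != 3 * n & e != 4 * n]%N -> ~~ (n %| e)%N.
Proof.
move=> lte /and5P[e0 e1 e2 e3 e4]; apply/dvdnP => -[d ed].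
have : (d < 5)%N by rewrite -(ltn_pmul2r (_ : 0 < n)%N) -?ed // /n addn3.
by case: d ed => [|[|[|[|[|d]]]]] //; move: e0 e1 e2 e3 e4; lia.
Qed.

Lemma unit_1Pq : unit (1 + q).
Proof.
have -> : 1 + q = (1 - q ^+ 2) / (1 - q ^+ 1).
  apply: (mulIf (@qvarX_neq1 1 isT)); rewrite divfK ?qvarX_neq1 //.
  by rewrite expr1 -[X in _ = X - _](expr1n _ 2) subr_sqr mulrC.
by apply: unitM; [|apply: unitV]; apply/unit_1q/not_dvd; rewrite /n; lia.
Qed.

Lemma unitX x k : unit x -> unit (x ^+ k).
Proof.
move=> ux; elim: k => [|k IHk]; first exact: (unit_q 0).
by rewrite exprS; apply: unitM.
Qed.

Lemma unit_poch e k : (forall i, (i < k)%N -> ~~ (n %| 5 * i + e)%N) ->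
  unit (poch (q ^+ 5) (q ^+ e) k).
Proof. by move=> nd; rewrite poch_qE; apply: unit_prod => i _; apply/unit_1q/nd. Qed.

Lemma vanish_poch1 e k i : (i < k)%N -> (n %| 5 * i + e)%N ->
  vanish 1 (poch (q ^+ 5) (q ^+ e) k).
Proof.
move=> ltik nd; rewrite poch_qE (bigD1 (Ordinal ltik)) //=.
apply: vanishMr; first exact: vanish_1q.
by apply: vanish_prod0 => j _; apply: vanish_1q0.
Qed.

(** For k > m the product (q^2;q^5)_k contains 1 - q^(4n). *)
Lemma truncated_sum :
  vanish 5 (\sum_(0 <= k < n)
        (1 + q ^+ (5 * k + 1)) * poch (q ^+ 5) (q ^+ 2) k ^+ 5
        / ((1 + q) * poch (q ^+ 5) (q ^+ 5) k ^+ 5)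
        * q ^+ (5 * k) - deformed_sum q 0 m).
Proof.
have lemn : (m.+1 <= n)%N by rewrite /n /m; lia.
pose c k := (1 + q ^+ (5 * k + 1)) * poch (q ^+ 5) (q ^+ 2) k ^+ 5
        / ((1 + q) * poch (q ^+ 5) (q ^+ 5) k ^+ 5) * q ^+ (5 * k).
have -> : deformed_sum q 0 m = \sum_(0 <= k < m.+1) c k.
  by rewrite (deformed_sum0 qvarX_neq1) big_mkord.
rewrite -/c (big_cat_nat (leq0n _) lemn) /= -/c addrAC subrr add0r.
rewrite big_seq; apply: vanish_sum => k; rewrite mem_index_iota => /andP[ltmk ltkn].
apply: vanishMr (vanish_q _); apply: vanishMr.
  apply: vanishMl.
    by apply: vanishD; [apply: vanish_one | apply: vanish_q].
  apply: (@vanishX n zeta 1 _ 5); apply: (vanish_poch1 ltmk).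
  by apply/dvdnP; exists 4%N; rewrite /n /m; lia.
apply/unit_vanish/unitV/unitM; first exact: unit_1Pq.
apply/unitX/unit_poch => i ltik; apply: not_dvd; move: ltkn ltik; rewrite /n; lia.
Qed.

Lemma quart_unit z i : vanish 1 z -> (i < m)%N -> unit (quart q z (5 * i + 5)).
Proof.
move=> z1 ltim; rewrite /quart; apply: (unitD prim_zeta).
  apply/unitX/unit_1q/not_dvd; move: ltim; rewrite /n /m; lia.
by apply/vanishN/vanishMr; rewrite // -exprM; apply: vanish_q.
Qed.

(** The cleared sum is a polynomial in Z over Z[q] that becomes zero at
    q = zeta, by [cleared_sum_root]. *)
Lemma cleared_vanish z : vanish 4 z ->
  vanish 5 (cleared_sum q z m - cleared_sum q 0 m).
Proof.
move=> z4.
pose W : {poly {poly int}} := cleared_sum ('X)%:P 'X m.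
have cleared_morph (A B : comPzRingType) (f : {rmorphism A -> B}) x y :
    f (cleared_sum x y m) = cleared_sum (f x) (f y) m.
  rewrite /cleared_sum /poch /quart rmorph_sum; apply: eq_bigr => k _.
  rewrite !(rmorphM, rmorphD, rmorphXn, rmorph_prod, rmorph1) /=.
  congr (_ * (_ * _) * (_ * _)); apply: eq_bigr => i _;
    by rewrite !(rmorphM, rmorphB, rmorphXn, rmorph1).
have at_zetaW : map_poly (at_zeta zeta) W = 0.
  rewrite cleared_morph /= map_polyC map_polyX /= at_zetaX /m.
  apply: cleared_sum_root.
  - by rewrite -rmorphXn /= (prim_expr_order prim_zeta) rmorph1.
  - move=> j /andP[j0 jm]; rewrite -exprM -rmorphXn /= -polyC1 -polyCB polyC_eq0.
    rewrite subr_eq0 eq_sym -(prim_order_dvd prim_zeta).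
    by apply: not_dvd; move: j0 jm; rewrite /n; lia.
  - move=> e; apply/eqP => /(congr1 (fun P : {poly algC} => P`_1)); apply/eqP.
    rewrite /quart -!rmorphXn /= -polyC1 -polyCB -rmorphXn /=.
    rewrite coefB coefC sub0r mulrC coefCM coefX mulr1 coef0 oppr_eq0 !expf_neq0 //.
    by rewrite (prim_root_eq0 prim_zeta) /n addn_eq0 andbF.
have hornerW y : (map_poly (@FracField.tofrac {poly int}) W).[y] = cleared_sum q y m.
  rewrite -[LHS]/((horner_eval y \o map_poly (@FracField.tofrac {poly int})) W).
  by rewrite cleared_morph /= map_polyC map_polyX /= /horner_eval hornerC hornerX.
by rewrite -!hornerW; apply: vanish_horner.
Qed.

Let p := q ^+ 5.
Let t := q ^+ 2 * p ^+ m.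
Let T := (1 - t) ^+ 2 / t.

Lemma t_qpow : t = q ^+ (4 * n).
Proof. by rewrite /t /p -exprM -exprD; congr (_ ^+ _); rewrite /n /m; lia. Qed.

Lemma vanish_T : vanish 2 T.
Proof.
rewrite /T t_qpow; apply: vanishMr; last exact/unit_vanish/unitV/unit_q.
by apply: (@vanishX n zeta 1 _ 2); apply: vanish_1q; rewrite dvdn_mull.
Qed.

Lemma vanish_T2 : vanish 4 (T ^+ 2).
Proof. exact: (@vanishX n zeta 2 _ 2 vanish_T). Qed.

Lemma quart_T_neq0 i : (i < m)%N -> quart q (T ^+ 2) (5 * i + 5) != 0.
Proof.
move=> ltim; apply: unit_neq0; apply: quart_unit => //.
exact: (vanish_leq _ vanish_T2).
Qed.

Lemma vanish_quad0 z e : vanish 0 z -> vanish 0 (quad q z e).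
Proof.
move=> z0; apply: vanishD; first exact: (@vanishX n zeta 0 _ 2 (vanish_1q0 _)).
exact: vanishMr z0 (vanish_q _).
Qed.

Lemma vanish_quadB j z e : vanish j z -> vanish j (quad q z e - quad q 0 e).
Proof.
move=> zj; rewrite /quad mul0r addr0 addrAC subrr add0r.
exact: vanishMr zj (vanish_q _).
Qed.

Lemma unit_quad z i : vanish 1 z -> (i < m)%N -> unit (quad q z (5 * i + 5)).
Proof.
move=> z1 ltim; rewrite /quad; apply: (unitD prim_zeta).
  apply/unitX/unit_1q/not_dvd.
    by move: ltim; rewrite /m; lia.
  by move: ltim; rewrite /m; lia.
exact: vanishMr z1 (vanish_q _).
Qed.

(** The factor 1 - q^(4n) above and the factor 1 - q^(2n) below are the only
    ones that vanish at zeta; their quotient is 1 + q^(2n). *)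
Lemma poch7_div_poch6 : vanish 0 (poch p (q ^+ 7) m / poch p (q ^+ 6) m).
Proof.
have i7 : (4 * r + 1 < m)%N by rewrite /m; lia.
have i6 : (2 * r < m)%N by rewrite /m; lia.
rewrite !poch_qE (bigD1 (Ordinal i7)) //= [X in _ / X](bigD1 (Ordinal i6)) //=.
have -> : (5 * (4 * r + 1) + 7 = (5 * (2 * r) + 6) * 2)%N by lia.
rewrite exprM one_minus_sqr_div ?qvarX_neq1 ?addnS //.
apply: vanishMr; first apply: vanishMr.
- by apply: vanishD; [apply: vanish_one | apply: vanish_q].
- by apply: vanish_prod0 => i _; apply: vanish_1q0.
apply/unit_vanish/unitV/unit_prod => i; rewrite -val_eqE /= => ne_i.
apply/unit_1q/not_dvd; have := ltn_ord i; move: ne_i; rewrite /m; lia.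
Qed.

(** The vanishing factor is 1 - q^n. *)
Lemma poch3_div_poch2 : vanish 1 (poch p (q ^+ 3) m / poch p (q ^+ 2) m).
Proof.
apply: vanishMr.
  apply: (@vanish_poch1 3 m r); first by rewrite /m; lia.
  exact: dvdnn.
apply/unit_vanish/unitV/unit_poch => i ltim.
by apply/not_dvd; move: ltim; rewrite /m; lia.
Qed.

(** Only the index i = 3 r + 1, where 5 i + 4 = 3 n, gives a factor
    [quad q z (5 * i + 4)] that is not a unit; [quad_factor] treats it exactly,
    and the others differ from their values at z = 0 by order 2. *)
Lemma vanish_product :
  vanish 3 (deformed_sum q (T ^+ 2) m) /\
  vanish 5 (deformed_sum q (T ^+ 2) m
   - qpochs [:: q ^+ 3; q ^+ 4; q ^+ 4; q ^+ 7] (q ^+ 5) m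
     / qpochs [:: q ^+ 2; q ^+ 5; q ^+ 5; q ^+ 6] (q ^+ 5) m
     * (1 + qint (4 * n) ^+ 2 * q ^- n / qint (3 * n) ^+ 2)).
Proof.
have i4 : (3 * r + 1 < m)%N by rewrite /m; lia.
pose N z := \prod_(i < m | i != Ordinal i4) quad q z (5 * i + 4).
pose L z := \prod_(i < m) quad q z (5 * i + 5).
have quadN z : \prod_(i < m) quad q z (5 * i + 4) = quad q z (3 * n) * N z.
  rewrite (bigD1 (Ordinal i4)) //=; congr (quad _ _ _ * _).
  by rewrite /n; lia.
have T1 : vanish 1 T by exact: (vanish_leq _ vanish_T).
have T0 : vanish 0 T by exact: (vanish_leq _ vanish_T).
have N0 z : vanish 0 z -> vanish 0 (N z).
  by move=> z0; apply: vanish_prod0 => i _; apply: vanish_quad0.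
have L0 z : vanish 0 z -> vanish 0 (L z).
  by move=> z0; apply: vanish_prod0 => i _; apply: vanish_quad0.
have Lu z : vanish 1 z -> unit (L z).
  by move=> z1; apply: unit_prod => i _; apply: unit_quad.
have k1 : vanish 2 (quad q T (3 * n)).
  apply: vanishD; last exact: vanishMr vanish_T (vanish_q _).
  by apply: (@vanishX n zeta 1 _ 2); apply: vanish_1q; rewrite dvdn_mull.
have A0 : vanish 1 (poch p (q ^+ 7) m / poch p (q ^+ 6) m
                    * (poch p (q ^+ 3) m / poch p (q ^+ 2) m)).
  exact: vanishMl poch7_div_poch6 poch3_div_poch2.
have A6 : poch p (q ^+ 6) m != 0 by apply: (poch_q_neq0 qvarX_neq1).
have A2 : poch p (q ^+ 2) m != 0 by apply: (poch_q_neq0 qvarX_neq1).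
have kE : quad q T (3 * n) = quad q 0 (3 * n)
    * (1 + qint (4 * n) ^+ 2 * q ^- n / qint (3 * n) ^+ 2).
  rewrite /quad mul0r addr0 /T t_qpow /qint.
  have -> : q ^+ (4 * n) = q ^+ (3 * n) * q ^+ n by rewrite -exprD; congr (_ ^+ _); lia.
  apply: quad_factor.
  - by rewrite -[q]expr1; apply: qvarX_neq1.
  - by apply: qvarX_neq1; rewrite /n; lia.
  - by rewrite expf_neq0 ?qvar_neq0.
  - by rewrite expf_neq0 ?qvar_neq0.
have -> : deformed_sum q (T ^+ 2) m =
   poch p (q ^+ 3) m * poch p (q ^+ 7) m * (quad q T (3 * n) * N T)
   / (poch p (q ^+ 2) m * poch p (q ^+ 6) m * L T).
  rewrite (deformed_sum_product qvar_neq0 qvarX_neq1 quart_T_neq0).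
  by rewrite -/t -/T !poch2_quad quadN.
have LT0 := unit_neq0 (Lu T T1); have L00 := unit_neq0 (Lu 0 (vanish0 _ _ _)).
have LTV : vanish 0 (L T)^-1 by exact/unit_vanish/unitV/Lu.
have L0V : vanish 0 (L 0)^-1 by apply/unit_vanish/unitV/Lu; apply: vanish0.
split.
  rewrite (_ : _ / _ = poch p (q ^+ 7) m / poch p (q ^+ 6) m
    * (poch p (q ^+ 3) m / poch p (q ^+ 2) m) * (quad q T (3 * n) * (N T / L T))).
    apply: (@vanishM n zeta 1 2) => //.
    by apply: vanishMr k1 _; apply: vanishMr LTV; apply: N0.
  exact: frac_regroup.
have -> : qpochs [:: q ^+ 3; q ^+ 4; q ^+ 4; q ^+ 7] (q ^+ 5) m
  = poch p (q ^+ 3) m * (poch p (q ^+ 4) m * (poch p (q ^+ 4) m * (poch p (q ^+ 7) m * 1))).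
  by rewrite /qpochs !big_cons big_nil.
have -> : qpochs [:: q ^+ 2; q ^+ 5; q ^+ 5; q ^+ 6] (q ^+ 5) m
  = poch p (q ^+ 2) m * (poch p (q ^+ 5) m * (poch p (q ^+ 5) m * (poch p (q ^+ 6) m * 1))).
  by rewrite /qpochs !big_cons big_nil.
have E4 : poch p (q ^+ 4) m ^+ 2 = quad q 0 (3 * n) * N 0 by rewrite poch_sqr quadN.
have E5 : poch p (q ^+ 5) m ^+ 2 = L 0 by rewrite poch_sqr.
rewrite (@prod_diff _ _ (poch p (q ^+ 3) m) _ _ _ (poch p (q ^+ 7) m) _ _ _ _ (N T) _ _
  A2 A6 L00 LT0 E4 E5 kE).
apply: (@vanishM n zeta 1 4) => //; apply: (@vanishM n zeta 2 2) => //.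
rewrite invfM; apply: vanishMr; last exact: vanishMr LTV L0V.
have dT e : vanish 2 (quad q T e - quad q 0 e) by apply: vanish_quadB; apply: vanish_T.
have quad0 z e : vanish 0 z -> vanish 0 (quad q z e) by apply: vanish_quad0.
have z0 : vanish 0 0 by apply: vanish0.
have dN : vanish 2 (N T - N 0).
  by apply: vanish_prodB => i _; [exact: quad0 | exact: quad0 | exact: dT].
have dL : vanish 2 (L T - L 0).
  by apply: vanish_prodB => i _; [exact: quad0 | exact: quad0 | exact: dT].
by apply: vanishB; [apply: vanishMr dN _; apply: L0 | apply: vanishMl _ dL; apply: N0].
Qed.

(** [cleared_vanish] compares the sums with their denominators cleared. The
    denominators at z = 0 and z = T^2 agree only to order 4, but the sum at
    T^2 itself vanishes, which supplies the fifth order. *)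
Lemma deformed_sum_congr : vanish 5 (deformed_sum q 0 m - deformed_sum q (T ^+ 2) m).
Proof.
have z1 : vanish 1 0 by apply: vanish0.
have Z1 : vanish 1 (T ^+ 2) by exact: (vanish_leq _ vanish_T2).
pose D z := \prod_(i < m) quart q z (5 * i + 5).
have Du z : vanish 1 z -> unit (D z).
  by move=> vz; apply: unit_prod => i _; apply: quart_unit.
have Eu : unit ((1 + q) * poch p p m).
  apply: unitM; first exact: unit_1Pq.
  by apply: (@unit_poch 5) => i ltim; apply: not_dvd; move: ltim; rewrite /n /m; lia.
have clearedE z : vanish 1 z ->
    cleared_sum q z m = (1 + q) * poch p p m * D z * deformed_sum q z m.
  move=> vz; apply: (cleared_sumE qvarX_neq1) => i ltim.
  by apply: unit_neq0; apply: quart_unit.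
rewrite (sum_diff (D (T ^+ 2)) _ _ (unit_neq0 Eu) (unit_neq0 (Du 0 z1))).
rewrite -!clearedE //; apply: vanishMr; last by apply/unit_vanish/unitV/unitM => //; apply: Du.
apply/vanishN/vanishB; first exact: cleared_vanish vanish_T2.
have [PT _] := vanish_product.
apply: (@vanishM n zeta 4 1); last exact: (vanish_leq _ PT).
apply: vanishMl; first exact: (unit_vanish n Eu).
have D0 z e : vanish 0 z -> vanish 0 (quart q z e).
  move=> vz; apply: vanishB; last by apply: vanishMr vz _; rewrite -exprM; apply: vanish_q.
  exact: (@vanishX n zeta 0 _ 4 (vanish_1q0 _)).
apply: vanish_prodB => i _.
- by apply: D0; apply: (vanish_leq _ vanish_T2).
- by apply: D0; apply: vanish0.
rewrite /quart mul0r subr0 addrAC subrr add0r; apply: vanishN.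
by apply: vanishMr vanish_T2 _; rewrite -exprM; apply: vanish_q.
Qed.

Lemma main_congr :
  congr_Phi n 5
    (\sum_(0 <= k < n)
        (1 + q ^+ (5 * k + 1)) * qpoch (q ^+ 2) (q ^+ 5) k ^+ 5
        / ((1 + q) * qpoch (q ^+ 5) (q ^+ 5) k ^+ 5)
        * q ^+ (5 * k))
     (qpochs [:: q ^+ 3; q ^+ 4; q ^+ 4; q ^+ 7] (q ^+ 5) m
     / qpochs [:: q ^+ 2; q ^+ 5; q ^+ 5; q ^+ 6] (q ^+ 5) m
     * (1 + qint (4 * n) ^+ 2 * q ^- n / qint (3 * n) ^+ 2)).
Proof.
apply: (vanish_congr prim_zeta).
set S := \sum_(_ <= _ < _) _; set R := _ * (1 + _).
rewrite -[S - R](subrKA (deformed_sum q 0 m)); apply: vanishD; first exact: truncated_sum.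
rewrite -[_ - R](subrKA (deformed_sum q (T ^+ 2) m)); apply: vanishD.
  exact: deformed_sum_congr.
exact: (vanish_product).2.
Qed.
End Main.

Theorem theorem1 (n : nat) (n_gt0 : (0 < n)%N) (n_mod5 : n = 3 %[mod 5]) :
  congr_Phi n 5
    (\sum_(0 <= k < n)
        (1 + qvar ^+ (5 * k + 1)) * qpoch (qvar ^+ 2) (qvar ^+ 5) k ^+ 5
        / ((1 + qvar) * qpoch (qvar ^+ 5) (qvar ^+ 5) k ^+ 5)
        * qvar ^+ (5 * k))
    (let m := ((4 * n - 2) %/ 5)%N in
     qpochs [:: qvar ^+ 3; qvar ^+ 4; qvar ^+ 4; qvar ^+ 7] (qvar ^+ 5) m
     / qpochs [:: qvar ^+ 2; qvar ^+ 5; qvar ^+ 5; qvar ^+ 6] (qvar ^+ 5) m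
     * (1 + qint (4 * n) ^+ 2 * qvar ^- n / qint (3 * n) ^+ 2)).
Proof.
have [zeta prim_zeta] := C_prim_root_exists n_gt0.
have [r nE] : exists r, n = (5 * r + 3)%N.
  by exists (n %/ 5)%N; rewrite {1}(divn_eq n 5) n_mod5 mulnC.
have mE : ((4 * n - 2) %/ 5 = 4 * r + 2)%N by rewrite nE; lia.
rewrite mE; move: prim_zeta; rewrite nE; exact: main_congr.
Qed.
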